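(* Let $p\in[0,1]$ and, for $\alpha\in(0,1)$, let $(X_t)_{t\in\mathbb{N}_0}$ be the Antlion Random Walk with parameters $\alpha$ and $p$ started at $X_0=0$. (i) If $0<\alpha<1/2$, then there exists a position $r\in\left[-\frac{1}{1-\alpha},\frac{1}{1-\alpha}\right]$ which is not reachable for the walk. (ii) If $1/2\le\alpha<1$, then any position $r\in\left[-\frac{1}{1-\alpha},\frac{1}{1-\alpha}\right]$ is reachable for the walk.
   Context: $\mathbb{N}=\{1,2,3,\dots\}$ and $\mathbb{N}_0=\mathbb{N}\cup\{0\}$. Let $(\xi_t)_{t\in\mathbb{N}}$ be independent, identically distributed random variables with $\mathbb{P}(\xi_t=-1)=p$ and $\mathbb{P}(\xi_t=1)=1-p$, where $p\in[0,1]$. The Antlion Random Walk (ARW) with parameters $\alpha$ and $p$ is the real-valued process defined by $X_0=0$ and $X_t=\alpha X_{t-1}+\xi_t$ for $t\in\mathbb{N}$; equivalently $X_t=\sum_{s=1}^{t}\alpha^{t-s}\xi_s$ for $t\in\mathbb{N}$. A position $x\in\mathbb{R}$ is called reachable if for every $\epsilon>0$ there exists $t\in\mathbb{N}$ such that $\mathbb{P}(|X_t-x|<\epsilon)>0$.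
   Formalization: Part (ii) is stated for 0 < p < 1 only: for p = 0 (or p = 1) the walk is deterministic with X_t ≥ 1 (or ≤ -1) for t ≥ 1, so r = -1/(1-α) (or 1/(1-α)) is not reachable and (ii) fails for every α in [1/2,1). *)

(* Defs.v *)
From HB Require Import structures.
From mathcomp Require Import all_boot all_order all_algebra finmap.
From mathcomp Require Import all_classical all_reals all_analysis.

Set Implicit Arguments.
Unset Strict Implicit.
Unset Printing Implicit Defensive.

Import Order.TTheory GRing.Theory Num.Theory.
Import numFieldNormedType.Exports.

Local Open Scope classical_set_scope.
Local Open Scope ring_scope.

(* Product rule over every finite subfamily with indices in A. *)
Definition mutually_independent (R : realType) (d : measure_display)
    (T : measurableType d) (P : probability T R) (I : choiceType) (A : set I)
    (Y : I -> {RV P >-> R}) : Prop :=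
  forall (J : {fset I}) (B : I -> set R),
    [set` J] `<=` A -> (forall i, i \in J -> measurable (B i)) ->
    P (\bigcap_(i in [set` J]) (Y i @^-1` B i)) =
      (\prod_(i <- J) P (Y i @^-1` B i))%E.

Definition identically_distributed (R : realType) (d : measure_display)
    (T : measurableType d) (P : probability T R) (I : Type) (A : set I)
    (Y : I -> {RV P >-> R}) : Prop :=
  forall i j, A i -> A j ->
  forall B : set R, measurable B -> distribution P (Y i) B = distribution P (Y j) B.

(* The steps are xi 1, xi 2, ...; the value xi 0 is unconstrained and is never
   used by the walk. *)
Definition iid_steps (R : realType) (d : measure_display)
    (T : measurableType d) (P : probability T R) (p : R)
    (xi : nat -> {RV P >-> R}) : Prop :=
  [/\ mutually_independent [set t | (0 < t)%N] xi,
      identically_distributed [set t | (0 < t)%N] xi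
    & forall t, (0 < t)%N ->
        P [set w | xi t w = -1] = p%:E /\ P [set w | xi t w = 1] = (1 - p)%:E].

Fixpoint antlion_walk (R : realType) (T : Type) (alpha : R)
    (xi : nat -> T -> R) (t : nat) (w : T) : R :=
  match t with
  | 0 => 0
  | s.+1 => alpha * antlion_walk alpha xi s w + xi s.+1 w
  end.

(* Only times t >= 1 count, so the starting point is not reachable for free. *)
Definition reachable (R : realType) (d : measure_display)
    (T : measurableType d) (P : probability T R) (X : nat -> T -> R)
    (x : R) : Prop :=
  forall e : R, 0 < e ->
    exists2 t : nat, (0 < t)%N & (0 < P [set w | `|X t w - x| < e]%R)%E.

(* Main.v *)
Require Import Defs.
From HB Require Import structures.
From mathcomp Require Import all_boot all_order all_algebra finmap.
From mathcomp Require Import all_classical all_reals all_analysis.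
From mathcomp Require Import measurable_realfun ring lra.
Import Order.TTheory GRing.Theory Num.Theory.
Import numFieldNormedType.Exports.
Local Open Scope classical_set_scope.
Local Open Scope ring_scope.

(* Write [rho = 1 / (1 - alpha)], so that [1 + alpha * rho = rho]. Almost surely
   all steps are [-1] or [1], and then [|X_t| <= rho] for every [t]; since
   [X_t = alpha X_(t-1) + xi_t], for [t >= 1] the walk keeps distance at least
   [1 - alpha * rho] from [0]. This is positive when [alpha < 1/2], and [0] is
   not reachable. When [1/2 <= alpha], the maps [x -> alpha x - 1] and
   [x -> alpha x + 1] send [[-rho, rho]] to two intervals that cover it, so
   every [r] has a backward orbit staying in [[-rho, rho]]; reading [t] digits
   of it gives a word of steps that ends within [alpha^t * rho] of [r], and by
   independence every finite word has positive probability. *)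

(** The two sample spaces may differ, so that a random path can be compared with a deterministic
    word, seen as a walk over [unit]. *)
Lemma antlion_walk_ext (R : realType) (T U : Type) (alpha : R)
    (xi : nat -> T -> R) (zeta : nat -> U -> R) (t : nat) (w : T) (u : U) :
  (forall s, (0 < s <= t)%N -> xi s w = zeta s u) ->
  antlion_walk alpha xi t w = antlion_walk alpha zeta t u.
Proof.
elim: t => [//|t IH] h /=.
rewrite IH ?h ?leqnn // => s /andP[s0 st].
by apply: h; rewrite s0 ltnW.
Qed.

Lemma antlion_walk_bound (R : realType) (T : Type) (alpha : R)
    (xi : nat -> T -> R) (w : T) (t : nat) :
  0 < alpha < 1 -> (forall s, (0 < s)%N -> `|xi s w| <= 1) ->
  `|antlion_walk alpha xi t w| <= 1 / (1 - alpha).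
Proof.
move=> /andP[a0 a1] h; elim: t => [|t IH] /=.
  by rewrite normr0 divr_ge0 // subr_ge0 ltW.
have -> : 1 / (1 - alpha) = alpha * (1 / (1 - alpha)) + 1.
  by field; rewrite subr_eq0 eq_sym lt_eqF.
apply: le_trans (ler_normD _ _) _.
by rewrite normrM (gtr0_norm a0) lerD ?h // ler_pM2l.
Qed.

Lemma antlion_walk_away0 (R : realType) (T : Type) (alpha : R)
    (xi : nat -> T -> R) (w : T) (t : nat) :
  0 < alpha < 1 -> (forall s, (0 < s)%N -> `|xi s w| = 1) -> (0 < t)%N ->
  1 - alpha / (1 - alpha) <= `|antlion_walk alpha xi t w|.
Proof.
move=> ha h; case: t => [//|t] _ /=.
have hb : `|antlion_walk alpha xi t w| <= 1 / (1 - alpha).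
  by apply: antlion_walk_bound => // s s0; rewrite h.
have /andP[a0 a1] := ha.
rewrite [X in `|X|]addrC; apply: le_trans (lerB_normD _ _).
rewrite h // lerB // normrM (gtr0_norm a0) ler_pM2l //.
by rewrite -[X in _ <= X]mul1r.
Qed.

(** Induction on [t] for all [r] at once: the last step is chosen first, and the remaining word aims
    at the preimage of [r], whose error is then multiplied by [alpha]. *)
Lemma antlion_word_approx (R : realType) (alpha r : R) (t : nat) :
  1 / 2 <= alpha < 1 -> `|r| <= 1 / (1 - alpha) ->
  exists2 s : nat -> R, (forall n, s n = -1 \/ s n = 1) &
    `|antlion_walk alpha (fun n (_ : unit) => s n) t tt - r| <=
      alpha ^+ t / (1 - alpha).
Proof.
move=> /andP[a2 a1]; have a0 : 0 < alpha by lra.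
have b0 : 0 < 1 - alpha by rewrite subr_gt0.
elim: t r => [|t IH] r hr.
  by exists (fun=> 1) => [|/=]; [right | rewrite sub0r normrN expr0].
pose c : R := if 0 <= r then 1 else -1.
have c1 : c = -1 \/ c = 1 by rewrite /c; case: ifP; [right|left].
have hr' : `|(r - c) / alpha| <= 1 / (1 - alpha).
  rewrite normrM normfV (gtr0_norm a0) ler_pdivrMr //.
  have e : 1 / (1 - alpha) * alpha = 1 / (1 - alpha) - 1 by field; rewrite gt_eqF.
  (* This is where [1 / 2 <= alpha] enters: for [0 <= r] the lower bound on [r - 1] is only [-1],
     which must be at least [1 - rho]; the case [r < 0] is symmetric. *)
  have h2 : 2 <= 1 / (1 - alpha) by rewrite ler_pdivlMr //; lra.
  rewrite e; move: hr; rewrite !ler_norml /c => /andP[? ?].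
  by case: (leP 0 r) => ?; apply/andP; split; lra.
have [s hs happ] := IH _ hr'.
exists (fun n => if n == t.+1 then c else s n) => [n|].
  by case: ifP => _; [exact: c1 | exact: hs].
rewrite /= eqxx (@antlion_walk_ext _ _ unit _ _ (fun n _ => s n) t tt tt); last first.
  by move=> n /andP[_ nt]; rewrite ltn_eqF.
set x := antlion_walk _ _ _ _ in happ *.
have -> : alpha * x + c - r = alpha * (x - (r - c) / alpha).
  by field; rewrite gt_eqF.
by rewrite normrM (gtr0_norm a0) exprS -mulrA ler_pM2l.
Qed.

Lemma measurable_antlion_walk (R : realType) (d : measure_display)
    (T : measurableType d) (P : probability T R) (alpha : R)
    (xi : nat -> {RV P >-> R}) (t : nat) :
  measurable_fun setT (antlion_walk alpha xi t).
Proof.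
elim: t => [|t IH]; first exact: measurable_cst.
apply: measurable_funD => //.
by apply: measurable_funM => //; exact: measurable_cst.
Qed.

Lemma measurable_antlion_near (R : realType) (d : measure_display)
    (T : measurableType d) (P : probability T R) (alpha : R)
    (xi : nat -> {RV P >-> R}) (t : nat) (x e : R) :
  measurable [set w | `|antlion_walk alpha xi t w - x| < e].
Proof.
rewrite -[X in measurable X]setTI.
rewrite (_ : [set w | _] = antlion_walk alpha xi t @^-1` ball x e).
  by apply: measurable_antlion_walk => //; exact: measurable_ball.
by apply/seteqP; split => w; rewrite /ball /= distrC.
Qed.

(** The atoms at [-1] and [1] are disjoint with masses [p] and [1 - p], so the complement of their
    union is null for each of the countably many steps. *)
Lemma ae_steps_norm1 (R : realType) (p : R) (d : measure_display)
    (T : measurableType d) (P : probability T R) (xi : nat -> {RV P >-> R}) :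
  iid_steps p xi -> {ae P, forall w, forall s, (0 < s)%N -> `|xi s w| = 1}.
Proof.
move=> [_ _ hp]; apply/ae_foralln => s.
case: s => [|s]; first by apply: aeW => w.
have [h1 h2] := hp s.+1 isT.
have m (x : R) : measurable [set w | xi s.+1 w = x].
  by rewrite -[[set w | _]]/(xi s.+1 @^-1` [set x]); exact: measurable_funPTI.
exists (~` ([set w | xi s.+1 w = -1] `|` [set w | xi s.+1 w = 1])); split.
- by apply/measurableC/measurableU; exact: m.
- have dsj : [set w | xi s.+1 w = -1] `&` [set w | xi s.+1 w = 1] = set0.
    by apply/seteqP; split => w //= [->] /eqP; rewrite eqNr oner_eq0.
  rewrite [LHS]probability_setC; last by apply: measurableU; exact: m.
  have -> : P ([set w | xi s.+1 w = -1] `|` [set w | xi s.+1 w = 1]) = 1%E.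
    rewrite measureU //; apply: etrans (congr2 adde h1 h2) _.
    by congr EFin; rewrite addrC subrK.
  by rewrite subee.
- by move=> w /= nw [h|h]; apply: nw => _; rewrite h ?normrN normr1.
Qed.

(** Independence turns the probability into a finite product of factors [p] and [1 - p], all
    positive since [p] is strictly between 0 and 1. *)
Lemma word_probability_gt0 (R : realType) (p : R) (d : measure_display)
    (T : measurableType d) (P : probability T R) (xi : nat -> {RV P >-> R})
    (s : nat -> R) (J : {fset nat}) :
  iid_steps p xi -> 0 < p < 1 -> (forall n, s n = -1 \/ s n = 1) ->
  [set` J] `<=` [set t | (0 < t)%N] ->
  (0 < P (\bigcap_(i in [set` J]) (xi i @^-1` [set s i])))%E.
Proof.
move=> [hind _ hxi] /andP[p0 p1] hs hJ.
rewrite (hind J (fun i => [set s i])) // big_seq.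
elim/big_ind: _ => [|x y x0 y0|i iJ]; [exact: lte01 | exact: mule_gt0 |].
have [h1 h2] := hxi i (hJ _ iJ).
by case: (hs i) => ->; rewrite [P _](h1, h2) lte_fin ?subr_gt0.
Qed.

(* Part (ii) carries the hypothesis 0 < p < 1: for p = 0 or p = 1 the walk is
   deterministic and part (ii) is false. Part (i) covers all p in [0, 1]. *)
Theorem theorem3p5 (R : realType) (p : R) (hp : 0 <= p <= 1)
    (alpha : R) (halpha : 0 < alpha < 1)
    (d : measure_display) (T : measurableType d) (P : probability T R)
    (xi : nat -> {RV P >-> R}) (hxi : iid_steps p xi) :
  (0 < alpha < 1 / 2 ->
     exists2 r : R, - (1 / (1 - alpha)) <= r <= 1 / (1 - alpha)
       & ~ reachable P (antlion_walk alpha xi) r) /\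
  (1 / 2 <= alpha < 1 -> 0 < p < 1 ->
     forall r : R, - (1 / (1 - alpha)) <= r <= 1 / (1 - alpha) ->
       reachable P (antlion_walk alpha xi) r).
Proof.
have b0 : 0 < 1 - alpha by case/andP: halpha => _; rewrite subr_gt0.
split=> [/andP[a0 a2]|ha hp01 r].
  have rho0 : 0 <= 1 / (1 - alpha) by rewrite divr_ge0 // ltW.
  exists 0; first by rewrite oppr_le0 rho0.
  have e0 : 0 < 1 - alpha / (1 - alpha).
    by rewrite subr_gt0 ltr_pdivrMr //; lra.
  (* With the radius equal to the lower bound on [|X_t|], the event lies in the null set where some
     step is not of modulus 1. *)
  move=> /(_ _ e0)[t t0]; rewrite measure_negligible ?ltxx //.
    exact: measurable_antlion_near.
  apply: negligibleS (ae_steps_norm1 _ _ _ _ _ _ hxi) => w /=.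
  rewrite subr0 => hlt hw.
  by have := @antlion_walk_away0 _ _ _ (fun n => xi n) _ _ halpha hw t0; rewrite leNgt hlt.
rewrite -ler_norml => hr e e0.
have [t t0 ht] : exists2 t, (0 < t)%N & alpha ^+ t / (1 - alpha) < e.
  have a1 : `|alpha| < 1 by case/andP: halpha => a0 a1; rewrite gtr0_norm.
  have eb : 0 < e * (1 - alpha) by rewrite mulr_gt0.
  have [N _ hN] := cvgr0_norm_lt _ (cvg_expr a1) _ eb.
  (* The successor guarantees a positive time, as reachability demands. *)
  exists N.+1 => //; rewrite ltr_pdivrMr //.
  by apply: le_lt_trans (ler_norm _) (hN N.+1 _) => /=.
exists t => //.
have [s hs happ] := antlion_word_approx _ _ _ t ha hr.
pose J := [fset i in iota 1 t]%fset.
have hJ i : (i \in J) = (0 < i <= t)%N by rewrite !inE mem_iota add1n ltnS.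
apply: lt_le_trans (word_probability_gt0 _ _ _ _ _ _ s J hxi hp01 hs _) _.
  by move=> i /=; rewrite hJ => /andP[].
apply: le_measure; rewrite ?inE.
- by apply: fin_bigcap_measurable => // i _; exact: measurable_funPTI.
- exact: measurable_antlion_near.
(* On this cylinder event the walk follows the word [s] up to time [t]. *)
move=> w /= hw; apply: le_lt_trans ht.
rewrite (antlion_walk_ext _ _ unit _ _ (fun n _ => s n) _ _ tt) // => i it.
by apply: hw; rewrite /= hJ.
Qed.
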